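(* Let $A_n=\frac{1}{2}\sqrt{F_nF_{n+1}}$ for $n\ge 1$ be the area of the $n$-th triangle of the Fibonacci--Theodorus spiral. Then $$\lim_{n\to\infty}\frac{A_{n+1}}{A_n}=\varphi .$$
   Context: $F_n$ denotes the $n$-th Fibonacci number: $F_1=F_2=1$ and $F_{n+1}=F_n+F_{n-1}$ for $n\ge 2$. $\varphi=(1+\sqrt5)/2$ is the golden ratio. The $n$-th triangle $\Delta_n$ of the Fibonacci--Theodorus spiral ($n\ge1$) is the right triangle with legs $\sqrt{F_{n}}$ and $\sqrt{F_{n+1}}$ and hypotenuse $\sqrt{F_{n+2}}$; its area is $A_n=\frac12\sqrt{F_nF_{n+1}}$. *)

(* Defs.v *)
From Stdlib Require Import Reals.
Open Scope R_scope.

(* The usual extension [fib 0 = 0] of F_1 = F_2 = 1 to the index 0. *)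
Fixpoint fib (n : nat) : nat :=
  match n with
  | O => O
  | S m => match m with
           | O => 1%nat
           | S k => (fib m + fib k)%nat
           end
  end.

Definition golden_ratio : R := (1 + sqrt 5) / 2.

(* Half the product of the legs sqrt F_n and sqrt F_(n+1) of the n-th triangle.
   Only n >= 1 is meaningful: [triangle_area 0 = 0] is a degenerate value,
   which does not affect limits as n tends to infinity. *)
Definition triangle_area (n : nat) : R :=
  1 / 2 * sqrt (INR (fib n) * INR (fib (S n))).

(* Main.v *)
Require Import Defs.
From Stdlib Require Import Reals Lra Lia.
From Coquelicot Require Import Coquelicot.
Open Scope R_scope.

(** Since [F_(n+1) - phi F_n = (1 - phi)^n] with [|1 - phi| < 1] and [F_n >= 1],
    the ratios [r_n = F_(n+1) / F_n] tend to [phi]. The ratio of consecutive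
    areas is [sqrt (r_(n+1) r_n)], which therefore tends to [sqrt (phi^2) = phi]. *)

Lemma fib_SS (n : nat) : fib (S (S n)) = (fib (S n) + fib n)%nat.
Proof. reflexivity. Qed.

Lemma fib_S_ge1 (n : nat) : 1 <= INR (fib (S n)).
Proof.
  apply (le_INR 1).
  induction n as [|n IH]; [simpl; lia | rewrite fib_SS; lia].
Qed.

Lemma golden_ratio_sqr : golden_ratio * golden_ratio = golden_ratio + 1.
Proof.
  assert (H : sqrt 5 * sqrt 5 = 5) by (apply sqrt_sqrt; lra).
  unfold golden_ratio; nra.
Qed.

Lemma golden_ratio_bounds : 1 < golden_ratio < 2.
Proof.
  assert (H : sqrt 5 * sqrt 5 = 5) by (apply sqrt_sqrt; lra).
  assert (H0 := sqrt_pos 5).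
  unfold golden_ratio; split; nra.
Qed.

(** Each step multiplies the error by [1 - golden_ratio]: the recurrence gives
    [(1 - golden_ratio) * F_(n+1) + F_n], and the last coefficient 1 equals [golden_ratio *
    golden_ratio - golden_ratio], so the factor comes out. *)
Lemma fib_error (n : nat) :
  INR (fib (S n)) - golden_ratio * INR (fib n) = (1 - golden_ratio) ^ n.
Proof.
  induction n as [|n IH]; [simpl; ring |].
  rewrite <- tech_pow_Rmult, <- IH, fib_SS, plus_INR.
  assert (H := golden_ratio_sqr).
  replace ((1 - golden_ratio) * (INR (fib (S n)) - golden_ratio * INR (fib n)))
    with ((1 - golden_ratio) * INR (fib (S n))
          + (golden_ratio * golden_ratio - golden_ratio) * INR (fib n)) by ring.
  rewrite H; ring.
Qed.

(** The index starts at 1 because [fib 0 = 0] cannot be a denominator. *)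
Lemma fib_ratio_lim :
  is_lim_seq (fun n => INR (fib (S (S n))) / INR (fib (S n))) golden_ratio.
Proof.
  apply is_lim_seq_ext with
    (fun n => golden_ratio + (1 - golden_ratio) ^ S n / INR (fib (S n))).
  { intros n; rewrite <- fib_error; assert (H := fib_S_ge1 n); field; lra. }
  replace (Finite golden_ratio) with (Finite (golden_ratio + 0))
    by (f_equal; ring).
  apply is_lim_seq_plus'; [apply is_lim_seq_const |].
  apply is_lim_seq_abs_0.
  (* Squeeze: dividing by [INR (fib (S n)) >= 1] can only shrink the geometric term. *)
  apply is_lim_seq_le_le with (fun _ => 0) (fun n => Rabs (1 - golden_ratio) ^ S n).
  - intros n; assert (H := fib_S_ge1 n).
    split; [apply Rabs_pos |].
    rewrite Rabs_div, <- RPow_abs, (Rabs_pos_eq (INR _)) by lra.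
    apply Rle_div_l; [lra |].
    assert (H0 := pow_le _ (S n) (Rabs_pos (1 - golden_ratio))); nra.
  - apply is_lim_seq_const.
  - apply -> is_lim_seq_incr_1.
    apply is_lim_seq_geom; assert (H := golden_ratio_bounds).
    rewrite Rabs_Rabsolu; apply Rabs_def1; lra.
Qed.

(** The common leg's [fib (S (S n))] cancels under the root; it is kept in both fractions so that
    each is a ratio of consecutive Fibonacci numbers. *)
Lemma triangle_area_ratio (n : nat) :
  triangle_area (S (S n)) / triangle_area (S n) =
  sqrt (INR (fib (S (S (S n)))) / INR (fib (S (S n)))
        * (INR (fib (S (S n))) / INR (fib (S n)))).
Proof.
  unfold triangle_area.
  assert (H0 := fib_S_ge1 n).
  assert (H1 := fib_S_ge1 (S n)).
  assert (Hpos : 0 < INR (fib (S n)) * INR (fib (S (S n)))) by nra.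
  assert (Hsqrt := sqrt_lt_R0 _ Hpos).
  transitivity (sqrt (INR (fib (S (S n))) * INR (fib (S (S (S n)))))
                / sqrt (INR (fib (S n)) * INR (fib (S (S n))))).
  { field; lra. }
  rewrite <- sqrt_div_alt by exact Hpos.
  f_equal; field; lra.
Qed.

Theorem theorem2p1 :
  is_lim_seq (fun n : nat => triangle_area (S n) / triangle_area n)
             (Finite golden_ratio).
Proof.
  (* Drops the term at 0, whose denominator [triangle_area 0] vanishes. *)
  apply is_lim_seq_incr_1.
  eapply is_lim_seq_ext; [intros n; symmetry; apply triangle_area_ratio |].
  assert (Hphi := golden_ratio_bounds).
  (* Puts the limit in the form [sqrt] of a product, to use continuity of [sqrt]. *)
  rewrite <- (sqrt_square golden_ratio) by lra.
  apply (is_lim_seq_continuous sqrt).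
  { apply continuity_pt_sqrt; nra. }
  apply is_lim_seq_mult'; [| exact fib_ratio_lim].
  (* The first factor is the second one shifted by one index. *)
  exact (proj1 (is_lim_seq_incr_1 _ _) fib_ratio_lim).
Qed.
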